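(* Let $s\geq 2$ be an integer and let $T$ be a tree with $n$ vertices in which every vertex has degree at most $s$, with Wiener index $\mathcal{W}$. Define $\mathcal{V}_{0,s}=T$ and, for $t\geq1$, let $\mathcal{V}_{t,s}$ be obtained from $\mathcal{V}_{t-1,s}$ by one application of the Vicsek fractal operation $V_s$. Then $\mathcal{V}_{t,s}$ has $n(s+1)^t$ vertices and its Wiener index is $$\mathcal{W}_{\mathcal{V}_{t,s}}=3^{t}(s+1)^{2t}\mathcal{W}+\frac{(s-2)(s+1)\,n^{2}(3^{t}-1)(s+1)^{2(t-1)}}{2}+\frac{(s+2)\,n(s+1)^{t-1}\left[3^{t}(s+1)^{t}-1\right]}{3s+2}.$$
   Context: All graphs are simple and connected. The distance $d_{uv}$ is the number of edges of a shortest path between $u$ and $v$; the Wiener index of a graph is the sum of $d_{uv}$ over all unordered pairs of distinct vertices. The Vicsek fractal operation $V_s$ applied to a tree whose maximum degree is at most $s$: every edge $uv$ is replaced by a path $u-a-b-v$ through two new vertices, and then each original vertex $v$ of degree $k_v$ (in the tree before the operation) receives $s-k_v$ new pendant leaves, so that every original vertex has degree $s$; the inserted vertices receive no further leaves. The result is again a tree of maximum degree at most $s$, so the operation can be iterated. *)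

(* Defs.v *)
From mathcomp Require Import all_boot all_order all_algebra.
Unset Printing Implicit Defensive.

Record fingraphT := FGraph { vert : finType; adj : rel vert }.
Arguments adj : clear implicits.

Definition simple_graph (G : fingraphT) : Prop :=
  symmetric (adj G) /\ irreflexive (adj G).

Definition connected_graph (G : fingraphT) : Prop :=
  forall u v : vert G, connect (adj G) u v.

Definition acyclic_graph (G : fingraphT) : Prop :=
  forall c : seq (vert G), uniq c -> 2 < size c -> ~~ cycle (adj G) c.

Definition is_tree (G : fingraphT) : Prop :=
  [/\ simple_graph G, connected_graph G & acyclic_graph G].

Definition deg (G : fingraphT) (v : vert G) : nat := #|[pred w | adj G v w]|.

Definition ball (G : fingraphT) (k : nat) (u : vert G) : {set vert G} :=
  iter k (fun A => A :|: [set y | [exists x in A, adj G x y]]) [set u].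

(* distance: least k (searched in 0 .. #|V|-1) such that v is within k steps
   of u, i.e. the length of a shortest u-v walk (= shortest path) in a
   connected graph. *)
Definition dist (G : fingraphT) (u v : vert G) : nat :=
  find (fun k => v \in ball G k u) (iota 0 #|vert G|).

Definition wiener (G : fingraphT) : nat :=
  \sum_(u : vert G) \sum_(v : vert G | enum_rank u < enum_rank v) dist G u v.

(* edges of G, each listed once (oriented by enum_rank) *)
Definition vedge (G : fingraphT) :=
  {p : vert G * vert G | adj G p.1 p.2 && (enum_rank p.1 < enum_rank p.2)}.
(* new pendant leaves: vertex v gets leaves indexed by j with deg v <= j < s,
   i.e. s - deg v leaves *)
Definition vleaf (s : nat) (G : fingraphT) :=
  {p : vert G * 'I_s | deg G p.1 <= p.2}.

Definition vvert (s : nat) (G : fingraphT) : finType :=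
  (vert G + (vedge G * bool) + vleaf s G)%type.

(* directed arcs: u - (e,false) - (e,true) - v for each edge e = uv,
   and v - leaf for each new leaf of v *)
Definition varc (s : nat) (G : fingraphT) (x y : vvert s G) : bool :=
  match x, y with
  | inl (inl u), inl (inr (e, false)) => u == (val e).1
  | inl (inr (e, false)), inl (inr (e', true)) => e == e'
  | inl (inr (e, true)), inl (inl v) => v == (val e).2
  | inl (inl u), inr l => u == (val l).1
  | _, _ => false
  end.

Definition vicsek (s : nat) (G : fingraphT) : fingraphT :=
  @FGraph (vvert s G) (fun x y => varc s G x y || varc s G y x).

(* Main.v *)
Require Import Defs.
From mathcomp Require Import all_boot all_order all_algebra.
From mathcomp Require Import zify ring.
Import GRing.Theory Num.Theory.
Set Implicit Arguments.
Unset Strict Implicit.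

(** A finite tree is handled through its metric: for [u != v] exactly one
    neighbour of [u] is closer to [v], and all the others are one step farther.
    The vertices of [vicsek s G] split into one star [K_{1,s}] around each
    vertex of [G], and for [x], [y] in the stars of [u != v] the new distance is
    [3 d(u,v) + eps_x + eps_y], where [eps] is [0] at a centre, [-1] at the half
    edge pointing to the other star and [+1] at the remaining [s - 1] vertices.
    Summing, two distinct stars contribute
    [3 (s+1)^2 d(u,v) + 2 (s+1) (s-2)] and each star contributes [s^2], so
    [W' = 3 (s+1)^2 W + (s-2) (s+1) n^2 + (s+2) n], which is then iterated. *)

(** A local substitute for [is_tree]: once such a [D] exists it must be the distance ([tm_dist]),
    and [tm_parent] can be checked neighbour by neighbour, with no talk of paths or cycles. *)
Record tree_metric (G : fingraphT) (D : vert G -> vert G -> nat) : Prop := {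
  tm_adj_sym : symmetric (adj G);
  tm_adj_irr : irreflexive (adj G);
  tm_sym : forall u v, D u v = D v u;
  tm_refl : forall u, D u u = 0;
  tm_parent : forall u v, u != v -> exists w,
    [/\ adj G u w, D u v = (D w v).+1
      & forall w', adj G u w' -> w' != w -> D w' v = (D u v).+1] }.

(** * Balls, walks and the distance *)

Section Ball.
Variable G : fingraphT.

Lemma ballP k (u v : vert G) :
  reflect (exists p, [/\ path (adj G) u p, last u p = v & size p <= k])
          (v \in ball G k u).
Proof.
elim: k v => [|k IH] v.
  rewrite /ball /= inE; apply: (iffP eqP) => [->|]; first by exists [::].
  by move=> [p [_ <-]]; case: p.
rewrite [ball _ _ _]iterS -/(ball G k u) !inE.
apply: (iffP orP) => [[/IH[p [pp pl ps]]|/exists_inP[x /IH[p [pp pl ps]] xv]]|].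
- by exists p; split=> //; apply: leqW.
- by exists (rcons p v); rewrite rcons_path last_rcons size_rcons pp pl.
move=> [p]; case/lastP: p => [[_ <- _]|p w].
  by left; apply/IH; exists [::].
rewrite rcons_path last_rcons size_rcons => -[/andP[pp pw] <- ps].
by right; apply/exists_inP; exists (last u p) => //; apply/IH; exists p.
Qed.

(** The bound on [d] matters because [find] only searches [iota 0 #|vert G|] and returns its length
    on failure. *)
Lemma dist_eqP (u v : vert G) d :
  d < #|vert G| -> (forall k, (v \in ball G k u) = (d <= k)) ->
  dist G u v = d.
Proof.
move=> dn dP; rewrite /dist (eq_find dP) -(subnKC (ltnW dn)) iotaD find_cat.
have /negPf-> : ~~ has (leq d) (iota 0 d).
  by apply/hasPn => k; rewrite mem_iota /= -ltnNge.
rewrite size_iota add0n; have: 0 < #|vert G| - d by rewrite subn_gt0.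
by case: (_ - _) => //= m _; rewrite leqnn addn0.
Qed.

(** A connecting path can be shortened to one without repeated vertices, so the least radius lies in
    the search range. *)
Lemma connected_dist_ball (u v : vert G) :
  connect (adj G) u v -> forall k, (v \in ball G k u) = (dist G u v <= k).
Proof.
case/connectP=> p0 /shortenP[p pp up _] vE.
have ps : size p < #|vert G| by have /= <- := card_uniqP up; apply: max_card.
have ex : exists k, v \in ball G k u by exists (size p); apply/ballP; exists p.
have mn := ex_minnP ex; case: mn => m vm mP.
have mE k : (v \in ball G k u) = (m <= k).
  apply/idP/idP => [/mP //|mk]; case/ballP: vm => q [qp ql qs].
  by apply/ballP; exists q; rewrite (leq_trans qs).
rewrite (dist_eqP _ mE) //; apply: leq_ltn_trans ps; apply: mP.
by apply/ballP; exists p.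
Qed.

Lemma ball_sym k (u v : vert G) :
  symmetric (adj G) -> (v \in ball G k u) = (u \in ball G k v).
Proof.
move=> sG; wlog suff: u v / v \in ball G k u -> u \in ball G k v.
  by move=> W; apply/idP/idP; apply: W.
case/ballP=> p [pp <- ps]; apply/ballP; exists (rev (belast u p)).
rewrite size_rev size_belast ps rev_path (eq_path (e' := adj G)) //.
split=> //; case: p {pp ps} => //= w p.
by rewrite rev_cons last_rcons.
Qed.

End Ball.

(** * Consequences of the tree metric axioms *)

Section TreeMetric.
Variables (G : fingraphT) (D : vert G -> vert G -> nat).
Hypothesis GD : tree_metric D.
Implicit Types u v w z : vert G.

Lemma tm_eq0 u v : (D u v == 0) = (u == v).
Proof.
have [->|/(tm_parent GD)[w [_ -> _]] //] := eqVneq u v.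
by rewrite (tm_refl GD).
Qed.

Lemma tm_adj u w v : adj G u w -> D w v = (D u v).+1 \/ D u v = (D w v).+1.
Proof.
move=> uw; have [uv|/(tm_parent GD)[p [up pD oD]]] := eqVneq u v.
  (* At [u = v], look from [w]: if its parent towards [u] were not [u], then [u] would be at
     positive distance from itself. *)
  left; subst v; have wu : w != u.
    by apply/eqP=> E; move: uw; rewrite E (tm_adj_irr GD).
  have [p [wp pD oD]] := tm_parent GD wu.
  have [pu|pu] := eqVneq u p; first by rewrite pD -pu.
  have := oD u; rewrite (tm_adj_sym GD) => /(_ uw pu).
  by rewrite (tm_refl GD).
have [->|/(oD _ uw)->] := eqVneq w p; [by right | by left].
Qed.

Lemma tm_adj1 u w : adj G u w -> D u w = 1.
Proof. by case/(tm_adj u); rewrite (tm_sym GD) (tm_refl GD). Qed.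

Lemma tm_parent_uniq u v w z : adj G u w -> adj G u z ->
  D u v = (D w v).+1 -> D u v = (D z v).+1 -> w = z.
Proof.
move=> uw uz wD zD; have uv: u != v by rewrite -tm_eq0 wD.
have [p [_ _ oD]] := tm_parent GD uv.
have E x : adj G u x -> D u v = (D x v).+1 -> x = p.
  by move=> ux xD; apply/eqP/contraT => /(oD _ ux); lia.
by rewrite (E w) // (E z).
Qed.

(** The path from [v] to [w] passes through [u], so it leaves [v] by the same first edge as the path
    to [u]. *)
Lemma tm_parent_stable u v w z : adj G u w -> adj G v z -> u != v ->
  D w v = (D u v).+1 -> (D v w == (D z w).+1) = (D v u == (D z u).+1).
Proof.
move=> uw vz uv wD.
have [p [vp pD oD]] := tm_parent GD (contra_neq esym uv).
have sD := tm_sym GD.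
have pw : D v w = (D p w).+1.
  have := tm_adj p uw; have := tm_adj w vp.
  by move: (sD u v) (sD w v) (sD u p) (sD w p); lia.
apply/eqP/eqP => zD.
  by rewrite (tm_parent_uniq vz vp zD pw).
by rewrite (tm_parent_uniq vz vp zD pD).
Qed.

Lemma tm_ball k u v : (v \in ball G k u) = (D u v <= k).
Proof.
apply/ballP/idP.
  move=> [p [pp <-]]; apply: leq_trans.
  elim: p u pp => [|w p IH] u /=; first by rewrite (tm_refl GD).
  by case/andP=> uw /IH; have := tm_adj (last w p) uw; lia.
elim: k u => [|k IH] u.
  by rewrite leqn0 tm_eq0 => /eqP->; exists [::].
have [->|uv] := eqVneq u v; first by exists [::].
have [w [uw -> _]] := tm_parent GD uv.
rewrite ltnS => /IH[p [pp pl ps]]; exists (w :: p).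
by rewrite /= uw.
Qed.

(** The descent from [u] to [v] meets each distance [D u v, ..., 0] once, hence [D u v + 1]
    different vertices. *)
Lemma tm_lt_card u v : D u v < #|vert G|.
Proof.
have Im k x : D x v = k -> exists p : seq (vert G),
    [/\ uniq p, size p = k.+1 & all (fun y => D y v <= k) p].
  elim: k x => [|k IH] x xD; first by exists [:: x]; rewrite /= xD.
  have xv : x != v by rewrite -tm_eq0 xD.
  have [w [_ wD _]] := tm_parent GD xv.
  have /IH[p [up sp ap]] : D w v = k by lia.
  exists (x :: p); rewrite /= up sp xD leqnn andbT; split=> //.
    by apply/negP=> /(allP ap); lia.
  by apply: sub_all ap => y; apply: leqW.
have [p [up <- _]] := Im _ u erefl.
by rewrite -(card_uniqP up) max_card.
Qed.

Lemma tm_dist u v : dist G u v = D u v.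
Proof. by apply: dist_eqP => [|k]; rewrite ?tm_lt_card ?tm_ball. Qed.

End TreeMetric.

(** * The distance of a tree is a tree metric *)

Section TreeDist.
Variable G : fingraphT.
Hypothesis treeG : is_tree G.
Implicit Types u v w : vert G.

Let symG : symmetric (adj G). Proof. by case: treeG => [[]]. Qed.
Let irrG : irreflexive (adj G). Proof. by case: treeG => [[]]. Qed.
Let ballE k u v : (v \in ball G k u) = (dist G u v <= k).
Proof. by apply: connected_dist_ball; case: treeG => _ /(_ u v). Qed.

Lemma dist_sym u v : dist G u v = dist G v u.
Proof.
have le a b : dist G a b <= dist G b a by rewrite -ballE ball_sym // ballE.
by apply/eqP; rewrite eqn_leq !le.
Qed.

Lemma dist_refl u : dist G u u = 0.
Proof. by apply/eqP; rewrite -leqn0 -ballE; apply/ballP; exists [::]. Qed.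

Lemma dist_adj u w v : adj G u w -> dist G u v <= (dist G w v).+1.
Proof.
move=> uw; have: v \in ball G (dist G w v) w by rewrite ballE.
case/ballP=> p [pp pl ps]; rewrite -ballE; apply/ballP.
by exists (w :: p); rewrite /= uw.
Qed.

Lemma dist_descent u v : u != v ->
  exists2 w, adj G u w & dist G u v = (dist G w v).+1.
Proof.
move=> uv; have: v \in ball G (dist G u v) u by rewrite ballE.
case/ballP=> -[[_ /= E]|w p /= [/andP[uw pp] pl ps]]; first by rewrite E eqxx in uv.
exists w => //; apply/eqP; rewrite eqn_leq dist_adj //=.
by apply: leq_ltn_trans ps; rewrite -ballE; apply/ballP; exists p.
Qed.

(* Two vertices on the same level are joined through their descents towards
   the root, which closes a cycle as soon as they are joined from above. *)
Lemma level_path v k a b : dist G a v = k -> dist G b v = k -> a != b ->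
  exists p, [/\ path (adj G) a p, last a p = b, uniq (a :: p), 1 < size p
             & all (fun x => dist G x v <= k) (a :: p)].
Proof.
have nz c m : dist G c v = m.+1 -> c != v.
  by apply: contra_eq_neq => ->; rewrite dist_refl.
elim: k a b => [|k IH] a b aD bD ab.
  have E c : dist G c v = 0 -> c = v.
    by move=> cD; apply: contra_eq cD => /dist_descent[w _ ->].
  by rewrite (E a) // (E b) // eqxx in ab.
have [a' aa' a'D] := dist_descent (nz _ _ aD).
have [b' bb' b'D] := dist_descent (nz _ _ bD).
have lo c x : dist G c v = k.+1 -> dist G x v <= k -> c != x.
  by move=> cD; apply: contraL => /eqP<-; rewrite cD ltnn.
have a'k : dist G a' v = k by lia.
have b'k : dist G b' v = k by lia.
have [E|a'b'] := eqVneq a' b'.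
  exists [:: a'; b]; rewrite /= aa' aD bD a'k E symG bb' !inE !leqnn leqnSn.
  by rewrite negb_or ab -E (lo a) ?a'k // eq_sym (lo b) ?a'k.
have [p [pp pl up sp ap]] := IH _ _ a'k b'k a'b'.
have nin c : dist G c v = k.+1 -> c \notin a' :: p.
  by move=> cD; apply/negP => /(allP ap); rewrite cD ltnn.
exists (rcons (a' :: p) b); split.
- by rewrite rcons_path /= aa' pp pl symG.
- by rewrite last_rcons.
- by rewrite cons_uniq rcons_uniq mem_rcons inE negb_or ab !nin.
- by rewrite size_rcons /=.
rewrite /= aD leqnn all_rcons bD leqnn a'k leqnSn /=.
by case/andP: ap => _; apply: sub_all => x; apply: leqW.
Qed.

(** A second neighbour [w'] of [u] that is not farther from [v] lies on the level of [u] or of [w].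
    In the first case a path from [w'] to [u] closes to a cycle by the edge [uw'], in the second a
    path from [w'] to [w] closes through [u]. *)
Lemma tree_metric_dist : tree_metric (dist G).
Proof.
have acyc : acyclic_graph G by case: treeG.
split=> //; [exact: dist_sym | exact: dist_refl |].
move=> u v uv; have [w uw wD] := dist_descent uv.
exists w; split=> // w' uw' ww'.
have := dist_adj v uw'; rewrite symG in uw'.
have := dist_adj v uw'; rewrite leq_eqVlt => /orP[/eqP //|].
rewrite ltnS => le1 le2; exfalso.
have [E|ne] := eqVneq (dist G w' v) (dist G u v).
  have w'u : w' != u by apply: contraTneq uw' => ->; rewrite irrG.
  have [p [pp pl up sp _]] := level_path E erefl w'u.
  apply: (negP (acyc (w' :: p) up sp)).
  by rewrite /= rcons_path pp pl symG.
have E : dist G w' v = dist G w v by lia.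
have [p [pp pl up sp ap]] := level_path E erefl ww'.
(* The path never rises above the level of [w], and [u] is one level higher. *)
have uN : u \notin w' :: p by apply/negP => /(allP ap); lia.
have uc : uniq (u :: w' :: p) by rewrite cons_uniq uN.
apply: (negP (acyc _ uc (ltnW sp))).
by rewrite /= rcons_path pp pl symG uw' symG.
Qed.

End TreeDist.

(** * Half edges as oriented edges *)

Section HalfEdges.
Variable G : fingraphT.
Implicit Types (e : vedge G) (b : bool) (u w : vert G).

(** The pair [(e, b)] is the inserted vertex on [e] next to [hsrc e b], in agreement with [varc]. *)
Definition hsrc e b : vert G := if b then (val e).2 else (val e).1.
Definition htgt e b : vert G := hsrc e (~~ b).

Lemma half_edge_exists u w : symmetric (adj G) -> irreflexive (adj G) ->
  adj G u w -> exists e b, hsrc e b = u /\ htgt e b = w.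
Proof.
move=> sG iG uw; case: (ltngtP (enum_rank u) (enum_rank w)) => uwr.
- have P : adj G (u, w).1 (u, w).2 && (enum_rank (u, w).1 < enum_rank (u, w).2).
    by rewrite uw.
  by exists (exist _ (u, w) P), false.
- have P : adj G (w, u).1 (w, u).2 && (enum_rank (w, u).1 < enum_rank (w, u).2).
    by rewrite sG uw.
  by exists (exist _ (w, u) P), true.
by move/val_inj/enum_rank_inj: uwr uw => ->; rewrite iG.
Qed.

Lemma half_edge_inj e b e' b' :
  hsrc e b = hsrc e' b' -> htgt e b = htgt e' b' -> (e, b) = (e', b').
Proof.
case: e e' => [[p q] pq] [[p' q'] pq']; have := pq; have := pq'.
rewrite /hsrc /htgt /= => /andP[_ l'] /andP[_ l].
(* With opposite flags the same edge would be listed in both orientations, against the order by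
   [enum_rank]. *)
case: b b' => -[] /= E1 E2; subst; try by congr (_, _); apply: val_inj.
- by rewrite ltnNge ltnW in l.
- by rewrite ltnNge ltnW in l.
Qed.

Lemma half_edge_adj e b : symmetric (adj G) -> adj G (hsrc e b) (htgt e b).
Proof.
by move=> sG; have /andP[pq _] := valP e; case: b; rewrite /htgt /hsrc //= sG.
Qed.

Lemma sum_half_edges u (f : vert G -> nat) :
  symmetric (adj G) -> irreflexive (adj G) ->
  \sum_(h : vedge G * bool | hsrc h.1 h.2 == u) f (htgt h.1 h.2)
  = \sum_(w | adj G u w) f w.
Proof.
move=> sG iG.
rewrite (partition_big (fun h : vedge G * bool => htgt h.1 h.2) (adj G u)) /=.
  apply: eq_bigr => w /(half_edge_exists sG iG)[e [b [eu ew]]].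
  rewrite (big_pred1 (e, b)) /= ?ew // => -[e' b'] /=.
  apply/andP/eqP => [[/eqP eu' /eqP ew']|[-> ->]]; last by rewrite eu ew.
  by apply: half_edge_inj; rewrite ?eu' ?ew'.
by move=> [e b] /= /eqP<-; apply: half_edge_adj.
Qed.

End HalfEdges.

Lemma sum_leaves s (G : fingraphT) (u : vert G) c :
  \sum_(l : vleaf s G | (val l).1 == u) c = (s - deg G u) * c.
Proof.
rewrite (partition_big (fun l : vleaf s G => (val l).2) (fun j => deg G u <= j)).
  rewrite -sum_nat_const_nat big_geq_mkord /=.
  apply: eq_bigr => j uj; rewrite (big_pred1 (exist _ (u, j) uj)) //.
by move=> [[v j] vj] /= /eqP <-.
Qed.

(** * Stars and the metric of the Vicsek graph *)

Section Vicsek.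
Variables (s : nat) (G : fingraphT) (D : vert G -> vert G -> nat).
Hypothesis GD : tree_metric D.
Implicit Types (x y : vvert s G) (u v w : vert G) (e : vedge G) (b : bool).

Local Notation cen u := (inl (inl u) : vvert s G).
Local Notation half e b := (inl (inr (e, b)) : vvert s G).
Local Notation vadj := (adj (vicsek s G)).

Let sG := tm_adj_sym GD.
Let iG := tm_adj_irr GD.

(* The vertices of [vicsek s G] split into stars, one around each vertex of
   [G]: the half edges and the leaves at [u] belong to [u]. *)
Definition vowner x : vert G :=
  match x with
  | inl (inl u) => u
  | inl (inr (e, b)) => hsrc e b
  | inr l => (val l).1
  end.

(* One more than the signed change of the distance to a distant star [v] when
   one moves from the centre of the star of [x] to [x]. *)
Definition voff x v : nat :=
  match x with
  | inl (inl u) => 1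
  | inl (inr (e, b)) =>
      if D (hsrc e b) v == (D (htgt e b) v).+1 then 0 else 2
  | inr l => 2
  end.

(** The [- 2] undoes the shift by one in each [voff]. Inside one star the formula gives 1 from the
    centre and 2 between outer vertices; it fails only for an outer vertex paired with itself. *)
Definition vdist x y : nat :=
  if x == y then 0
  else 3 * D (vowner x) (vowner y) + voff x (vowner y) + voff y (vowner x) - 2.

Lemma vadj_sym : symmetric vadj.
Proof. by move=> x y; rewrite /= orbC. Qed.

Lemma vadj_irr : irreflexive vadj.
Proof. by case=> [[u|[e []]]|l]. Qed.

Lemma vadj_cen u x : vadj (cen u) x = (vowner x == u) && (x != cen u).
Proof.
case: x => [[v|[e []]]|l] /=; rewrite ?orbF ?andbT ?[u == _]eq_sym //=.
apply/esym/negbTE; rewrite negb_and negbK.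
by have [->|] := eqVneq v u; rewrite ?eqxx ?orbT.
Qed.

Lemma vadj_half e b x :
  vadj (half e b) x = (x == cen (hsrc e b)) || (x == half e (~~ b)).
Proof.
have cE v w : (cen v == cen w) = (v == w) by [].
have hE (e1 e2 : vedge G) (b1 b2 : bool) :
  (half e1 b1 == half e2 b2) = (e1 == e2) && (b1 == b2) by [].
case: x => [[v|[e' b']]|l]; first by rewrite cE orbF; case: b; rewrite /= ?orbF.
  by rewrite hE; case: b; case: b' => /=; rewrite ?orbF ?andbF ?andbT // eq_sym.
by case: b.
Qed.

Lemma vadj_leaf (l : vleaf s G) x :
  vadj (inr l) x = (x == cen (val l).1).
Proof.
have cE v w : (cen v == cen w) = (v == w) by [].
by case: x => [[v|[e' []]]|l'] //; rewrite cE.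
Qed.

Lemma voff_self x : x != cen (vowner x) -> voff x (vowner x) = 2.
Proof.
by case: x => [[u|[e b]]|l] //= h; [rewrite eqxx in h | rewrite (tm_refl GD)].
Qed.

(** Seen from [y], both ends of an edge leading away lie in the same direction, by
    [tm_parent_stable]. If [y] is in the star of [hsrc e b], the only vertex pointing to the other
    end is [half e b], which is excluded. *)
Lemma voff_edge e b y : y != half e b ->
  D (htgt e b) (vowner y) = (D (hsrc e b) (vowner y)).+1 ->
  voff y (htgt e b) = voff y (hsrc e b).
Proof.
have uw := half_edge_adj e b sG.
case: y => [[u|[e' b']]|l] //= ne; have vz := half_edge_adj e' b' sG.
have [E|ne2 wD] := eqVneq (hsrc e b) (hsrc e' b'); last first.
  by rewrite (tm_parent_stable GD uw vz).
rewrite -!E (tm_refl GD) (tm_adj1 GD uw) eqSS eq_sym (tm_eq0 GD).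
case: eqP => // E2; case/eqP: ne; congr (inl (inr _)).
by apply: half_edge_inj.
Qed.

Lemma voff_half e b v : voff (half e b) v =
  if D (hsrc e b) v == (D (htgt e b) v).+1 then 0 else 2.
Proof. by []. Qed.

Lemma vdist_ne x y : x != y -> vdist x y =
  3 * D (vowner x) (vowner y) + voff x (vowner y) + voff y (vowner x) - 2.
Proof. by rewrite /vdist => /negPf->. Qed.

Lemma vdist_xx x : vdist x x = 0.
Proof. by rewrite /vdist eqxx. Qed.

Lemma vdist_sym x y : vdist x y = vdist y x.
Proof. by rewrite /vdist eq_sym (tm_sym GD) addnAC. Qed.

Lemma vdist_away x y : x != y -> voff x (vowner y) = 2 ->
  vdist x y = (vdist (cen (vowner x)) y).+1.
Proof.
move=> xy x2; rewrite (vdist_ne xy) x2.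
have [<-|cy] := eqVneq (cen (vowner x)) y.
  by rewrite vdist_xx /= (tm_refl GD).
rewrite vdist_ne //=; have [E|] := eqVneq (vowner x) (vowner y).
  have y2 : voff y (vowner y) = 2 by apply: voff_self; rewrite -E eq_sym.
  by rewrite E y2 (tm_refl GD).
by rewrite -(tm_eq0 GD); lia.
Qed.

Lemma vdist_cen_parent u y : cen u != y -> exists x,
  [/\ vadj (cen u) x, vdist (cen u) y = (vdist x y).+1
    & forall x', vadj (cen u) x' -> x' != x ->
                 vdist x' y = (vdist (cen u) y).+1].
Proof.
move=> uy; have [yu|yu] := eqVneq (vowner y) u.
  have y2 : voff y u = 2 by rewrite -yu voff_self // yu eq_sym.
  have -> : vdist (cen u) y = 1 by rewrite vdist_ne //= yu y2 (tm_refl GD).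
  exists y; rewrite vadj_cen yu eqxx eq_sym uy vdist_xx; split=> // x'.
  rewrite vadj_cen => /andP[/eqP xu xc] xy.
  by rewrite vdist_ne // xu yu y2 (tm_refl GD) -xu voff_self // xu.
(* For [y] in another star, the next vertex is the half edge towards the parent [w] of [u]; all
   other neighbours have offset 2. *)
have [w [uw wD oD]] := tm_parent GD (contra_neq esym yu).
have D0 : 0 < D u (vowner y) by rewrite wD.
have [e [b [eu ew]]] := half_edge_exists sG iG uw.
have hy : half e b != y by apply: contra_neq yu => <-.
exists (half e b); split.
- by rewrite vadj_cen /= eu eqxx.
- by rewrite !vdist_ne // voff_half /= eu ew wD eqxx; lia.
move=> x'; rewrite vadj_cen => /andP[/eqP xu xc] xh.
have x'y : x' != y by apply: contra_neq yu => <-.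
rewrite !vdist_ne // xu /=.
suff -> : voff x' (vowner y) = 2 by lia.
case: x' xu xc xh x'y => [[u'|[e' b']]|l] //=; first by move=> ->; rewrite eqxx.
move=> e'u _ neh _; rewrite e'u (oD (htgt e' b')).
- by case: eqP => //; lia.
- by rewrite -e'u half_edge_adj.
apply: contra_neq neh => E; congr (inl (inr _)).
by apply: half_edge_inj; rewrite ?e'u ?eu ?E.
Qed.

Lemma vdist_half_parent e b y : half e b != y -> exists x,
  [/\ vadj (half e b) x, vdist (half e b) y = (vdist x y).+1
    & forall x', vadj (half e b) x' -> x' != x ->
                 vdist x' y = (vdist (half e b) y).+1].
Proof.
move=> xy; have uw := half_edge_adj e b sG.
have srcN : hsrc e (~~ b) = htgt e b by [].
have tgtN : htgt e (~~ b) = hsrc e b by rewrite /htgt negbK.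
(* If the edge leads away from [y], the parent is the centre; otherwise it is the other half of the
   edge. *)
case: (tm_adj GD (vowner y) uw) => wD.
  have hC : vdist (half e b) y = (vdist (cen (hsrc e b)) y).+1.
    by apply: vdist_away; rewrite // voff_half wD; case: eqP => //; lia.
  exists (cen (hsrc e b)); split=> //; first by rewrite vadj_half eqxx.
  move=> x'; rewrite vadj_half => /orP[/eqP->|/eqP-> _]; first by rewrite eqxx.
  have xy' : half e (~~ b) != y.
    apply: contra_eq_neq wD => <- /=; rewrite srcN (tm_refl GD); lia.
  rewrite !vdist_ne // !voff_half /= srcN tgtN wD eqxx.
  rewrite eq_sym in xy; rewrite (voff_edge xy wD).
  by case: eqP => [|_]; lia.
have D0 : hsrc e b != vowner y by rewrite -(tm_eq0 GD) wD.
have cy : cen (hsrc e b) != y by apply: contra_neq D0 => <-.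
have hC : vdist (cen (hsrc e b)) y = (vdist (half e b) y).+1.
  by rewrite !vdist_ne // voff_half /= wD eqxx; lia.
exists (half e (~~ b)); split.
- by rewrite vadj_half eqxx orbT.
(* When [y] is the other half, both offsets are 0 and the distance is [3 * 1 - 2 = 1]. *)
- have [E|xy'] := eqVneq (half e (~~ b)) y.
    rewrite -E vdist_xx vdist_ne; last by rewrite E.
    rewrite !voff_half /= srcN tgtN !(tm_refl GD) (tm_adj1 GD uw) (tm_sym GD).
    by rewrite (tm_adj1 GD uw).
  rewrite !vdist_ne // !voff_half /= srcN tgtN wD eqxx.
  rewrite eq_sym in xy'; have := voff_edge xy'; rewrite srcN tgtN => /(_ wD) ->.
  by case: eqP => [|_]; lia.
by move=> x'; rewrite vadj_half => /orP[/eqP->|/eqP->] //; rewrite eqxx.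
Qed.

Lemma vdist_leaf_parent (l : vleaf s G) y : inr l != y -> exists x,
  [/\ vadj (inr l) x, vdist (inr l) y = (vdist x y).+1
    & forall x', vadj (inr l) x' -> x' != x ->
                 vdist x' y = (vdist (inr l) y).+1].
Proof.
move=> ly; exists (cen (val l).1); rewrite vadj_leaf eqxx; split=> //; last first.
  by move=> x'; rewrite vadj_leaf => ->.
exact: vdist_away.
Qed.

Lemma tree_metric_vicsek : tree_metric (G := vicsek s G) vdist.
Proof.
split; [exact: vadj_sym | exact: vadj_irr | exact: vdist_sym | exact: vdist_xx |].
case=> [[u|[e b]]|l] y.
- exact: vdist_cen_parent.
- exact: vdist_half_parent.
- exact: vdist_leaf_parent.
Qed.

Hypothesis degs : forall u, deg G u <= s.

Lemma card_star u : \sum_(x | vowner x == u) 1 = s.+1.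
Proof.
rewrite !big_sumType /= big_pred1_eq sum_leaves muln1.
rewrite (eq_bigl (fun h : vedge G * bool => hsrc h.1 h.2 == u)) => [|[]//].
rewrite (sum_half_edges u (fun=> 1)) // sum1_card -/(deg G u).
by rewrite -addnA subnKC ?add1n.
Qed.

(** The centre contributes 1 and the other [s] vertices 2 each, except that for [u != v] the half
    edge towards the unique closer neighbour contributes 0. *)
Lemma sum_voff_star u v :
  \sum_(x | vowner x == u) voff x v + 2 * (u != v) = 2 * s + 1.
Proof.
rewrite !big_sumType /= big_pred1_eq sum_leaves.
rewrite (eq_bigl (fun h : vedge G * bool => hsrc h.1 h.2 == u)) => [|[]//].
rewrite (eq_bigr (fun h : vedge G * bool =>
  if D u v == (D (htgt h.1 h.2) v).+1 then 0 else 2)); last first.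
  by move=> [e b] /= /eqP->.
rewrite (sum_half_edges u (fun w => if D u v == (D w v).+1 then 0 else 2)) //.
suff: \sum_(w | adj G u w) (if D u v == (D w v).+1 then 0 else 2) + 2 * (u != v)
      = 2 * deg G u by move=> E; have := degs u; lia.
have degE : 2 * deg G u = \sum_(w | adj G u w) 2.
  by rewrite sum_nat_const mulnC.
rewrite degE; have [->|uv] := eqVneq u v.
  by rewrite addn0; apply: eq_bigr => w _; rewrite (tm_refl GD).
have [p [up pD oD]] := tm_parent GD uv.
rewrite (bigD1 p) //= [RHS](bigD1 p) //= pD eqxx add0n muln1 addnC.
congr (_ + _); apply: eq_bigr => w /andP[uw wp]; rewrite -pD (oD w uw wp).
by case: eqP => //; lia.
Qed.

Lemma card_vicsek : #|vert (vicsek s G)| = #|vert G| * s.+1.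
Proof.
rewrite -sum1_card (partition_big vowner xpredT) //=.
by rewrite (eq_bigr (fun=> s.+1)) ?sum_nat_const // => u _; apply: card_star.
Qed.

Lemma deg_vicsek x : 2 <= s -> deg (vicsek s G) x <= s.
Proof.
move=> s2; rewrite /deg; case: x => [[u|[e b]]|l].
- have := card_star u; rewrite (bigD1 (cen u)) //= add1n sum1_card => -[cE].
  by rewrite (eq_card (vadj_cen u)); apply: eq_leq; exact: cE.
- rewrite (eq_card (vadj_half e b)); apply: leq_trans s2.
  by rewrite (card2 (cen (hsrc e b))).
by rewrite (eq_card (vadj_leaf l)) card1 ltnW.
Qed.

End Vicsek.

(** * Recursion for the Wiener index *)

Lemma double_wiener (G : fingraphT) (D : vert G -> vert G -> nat) :
  tree_metric D -> 2 * wiener G = \sum_u \sum_v D u v.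
Proof.
move=> GD; have WE : wiener G =
    \sum_u \sum_(v | enum_rank u < enum_rank v) D u v.
  by apply: eq_bigr => u _; apply: eq_bigr => v _; rewrite (tm_dist GD).
have WE' : wiener G = \sum_u \sum_(v | enum_rank v < enum_rank u) D u v.
  rewrite WE (exchange_big_dep xpredT) //=; apply: eq_bigr => u _.
  by apply: eq_bigr => v _; rewrite (tm_sym GD).
rewrite mul2n -addnn {1}WE WE' -big_split /=; apply: eq_bigr => u _.
rewrite [RHS](bigID (fun v => enum_rank u < enum_rank v)) /=; congr (_ + _).
rewrite [RHS](bigD1 u) ?ltnn //= (tm_refl GD) add0n; apply: eq_bigl => v.
by rewrite -leqNgt ltn_neqAle andbC (inj_eq val_inj) (inj_eq enum_rank_inj).
Qed.

Section Recursion.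
Variables (s : nat) (G : fingraphT) (D : vert G -> vert G -> nat).
Hypothesis GD : tree_metric D.
Hypothesis degs : forall u, deg G u <= s.
Let n := #|vert G|.

Lemma sum_vowner (f : vert G -> nat) :
  \sum_(x : vvert s G) f (vowner x) = s.+1 * \sum_u f u.
Proof.
rewrite (partition_big (@vowner s G) xpredT) //= big_distrr /=.
apply: eq_bigr => u _; rewrite -(card_star GD degs u) big_distrl /=.
by apply: eq_bigr => x /eqP->; rewrite mul1n.
Qed.

(** [sum_voff_star] over all [n ^ 2] pairs, [n * (n - 1)] of them distinct; negative terms change
    sides to avoid truncated subtraction. *)
Lemma sum_voff : \sum_(x : vvert s G) \sum_v voff D x v + 2 * n ^ 2
  = n ^ 2 * (2 * s + 1) + 2 * n.
Proof.
have -> : n ^ 2 * (2 * s + 1) = \sum_(u : vert G) \sum_(v : vert G) (2 * s + 1).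
  by rewrite !sum_nat_const mulnA.
rewrite (partition_big (@vowner s G) xpredT) //=.
have -> : 2 * n ^ 2 =
    \sum_(u : vert G) \sum_(v : vert G) 2 * (u != v) + 2 * n.
  have -> : 2 * n = \sum_(u : vert G) \sum_(v : vert G) 2 * (u == v).
    rewrite (eq_bigr (fun=> 2)) ?sum_nat_const 1?mulnC // => u _.
    by rewrite (bigD1 u) //= eqxx big1 // => v /negPf; rewrite eq_sym => ->.
  rewrite -big_split /=.
  rewrite (eq_bigr (fun=> n * 2)); first by rewrite sum_nat_const mulnA mulnC.
  move=> u _.
  rewrite -big_split /= (eq_bigr (fun=> 2)) ?sum_nat_const // => v _.
  by case: (u == v).
rewrite addnA -big_split /=; congr (_ + _); apply: eq_bigr => u _.
rewrite exchange_big -big_split /=; apply: eq_bigr => v _.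
exact: sum_voff_star.
Qed.

(** A form of [vdist] without subtraction or case distinction, fit for summing over all ordered
    pairs: the factors [x == y] correct the diagonal. *)
Lemma vdistE (x y : vvert s G) :
  vdist D x y + 2 + (x == y) * (voff D x (vowner x) * 2)
  = D (vowner x) (vowner y) * 3 + voff D x (vowner y) + voff D y (vowner x)
    + (x == y) * 2.
Proof.
have [<-|xy] := eqVneq x y; first by rewrite vdist_xx (tm_refl GD); lia.
rewrite vdist_ne // !mul0n !addn0 [_ * 3]mulnC subnK //.
have [E|] := eqVneq (vowner x) (vowner y); last by rewrite -(tm_eq0 GD); lia.
(* Inside one star both offsets are positive, so [- 2] does not truncate. *)
have pos (z : vvert s G) : 0 < voff D z (vowner z).
  have [->|/(voff_self GD)->] // := eqVneq z (inl (inl (vowner z)) : vvert s G).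
by have := pos x; have := pos y; rewrite E; lia.
Qed.

Lemma wiener_vicsek :
  wiener (vicsek s G) + 2 * s.+1 * n ^ 2
  = 3 * s.+1 ^ 2 * wiener G + s * s.+1 * n ^ 2 + (s + 2) * n.
Proof.
have cV := card_vicsek GD degs.
have S1 := sum_voff; have WG := double_wiener GD.
have WV := double_wiener (tree_metric_vicsek s GD).
have cst : \sum_(x : vvert s G) \sum_(y : vvert s G) 2 = 2 * (n * s.+1) ^ 2.
  by rewrite !sum_nat_const cV -/n; lia.
have dg (f : vvert s G -> nat) :
    \sum_(x : vvert s G) \sum_(y : vvert s G) (x == y) * f x = \sum_x f x.
  apply: eq_bigr => x _; rewrite (bigD1 x) //= eqxx mul1n big1 ?addn0 // => y.
  by rewrite eq_sym => /negPf->.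
have off : \sum_(x : vvert s G) voff D x (vowner x) * 2 = n * (2 * s + 1) * 2.
  rewrite -big_distrl /= (partition_big (@vowner s G) xpredT) //=.
  rewrite (eq_bigr (fun=> 2 * s + 1)) ?sum_nat_const // => u _.
  rewrite -(sum_voff_star GD degs u u) eqxx addn0.
  by apply: eq_bigr => x /eqP->.
have mid : \sum_(x : vvert s G) \sum_(y : vvert s G) voff D x (vowner y)
    = s.+1 * \sum_(x : vvert s G) \sum_v voff D x v.
  by rewrite big_distrr; apply: eq_bigr => x _; apply: sum_vowner.
have main : \sum_(x : vvert s G) \sum_(y : vvert s G) D (vowner x) (vowner y) * 3
    = s.+1 ^ 2 * (\sum_u \sum_v D u v) * 3.
  under eq_bigr => x _ do rewrite -big_distrl /= sum_vowner.
  rewrite -big_distrl /= -big_distrr /= (sum_vowner (fun u => \sum_v D u v)).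
  by rewrite !mulnA.
have : \sum_(x : vvert s G) \sum_(y : vvert s G)
     (vdist D x y + 2 + (x == y) * (voff D x (vowner x) * 2))
   = \sum_(x : vvert s G) \sum_(y : vvert s G)
     (D (vowner x) (vowner y) * 3 + voff D x (vowner y) + voff D y (vowner x)
      + (x == y) * 2).
  by apply: eq_bigr => x _; apply: eq_bigr => y _; apply: vdistE.
under eq_bigr => x _ do rewrite !big_split /=.
under [RHS]eq_bigr => x _ do rewrite !big_split /=.
rewrite !big_split /= -WV cst !dg off main mid -WG.
rewrite [\sum_x \sum_y voff D y _]exchange_big /= mid sum_nat_const cV -/n.
move: (\sum_x \sum_v voff D x v) S1 (wiener _) (wiener _) => S S1 W' W.
(* The total offset enters through [mid] with the factor [s.+1], so [S1] is scaled to match. *)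
have := congr1 (muln s.+1) S1; nia.
Qed.

End Recursion.

(** * Iteration and the closed formula *)

Unset Implicit Arguments.
Local Open Scope ring_scope.

(** The invariant carries a tree metric instead of [is_tree], so acyclicity is invoked only for [T].
    The bound [2 <= s] keeps the inserted vertices, of degree 2, within the degree bound. *)
Lemma vicsek_iter (s : nat) (T : fingraphT) (t : nat) :
  (2 <= s)%N -> is_tree T -> (forall v : vert T, (deg T v <= s)%N) ->
  let V := iter t (vicsek s) T in
  [/\ exists D : vert V -> vert V -> nat, tree_metric D,
      forall v : vert V, (deg V v <= s)%N
    & #|vert V| = (#|vert T| * (s + 1) ^ t)%N].
Proof.
move=> s2 treeT degT; elim: t => [|t [[D VD] degV cardV]] /=.
  by rewrite muln1; split=> //; exists (dist T); apply: tree_metric_dist.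
split.
- by exists (vdist D); apply: tree_metric_vicsek.
- by move=> v; apply: deg_vicsek VD _ _ _.
by rewrite (card_vicsek VD) // cardV expnSr addn1 mulnA.
Qed.

Theorem theorem3 (s : nat) (T : fingraphT) (t : nat) :
  (2 <= s)%N -> is_tree T -> (forall v : vert T, (deg T v <= s)%N) ->
  let n := #|vert T| in
  let V := iter t (vicsek s) T in
  #|vert V| = (n * (s + 1) ^ t)%N /\
  (wiener V)%:R =
    (3 ^+ t * (s + 1)%:R ^+ (2 * t) * (wiener T)%:R
     + (s%:R - 2) * (s + 1)%:R * n%:R ^+ 2 * (3 ^+ t - 1)
         * (s + 1)%:R ^+ (2 * t.-1) / 2
     + (s + 2)%:R * n%:R * (s + 1)%:R ^+ t.-1
         * (3 ^+ t * (s + 1)%:R ^+ t - 1) / (3 * s + 2)%:R : rat).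
Proof.
move=> s2 treeT degT n V; split.
  by have [] := vicsek_iter s T t s2 treeT degT.
rewrite {}/V; elim: t => [|t IH].
  by rewrite /= !expr0 subrr !(mulr0, mul0r, mul1r, addr0).
have [[D VD] degV cardV] := vicsek_iter s T t s2 treeT degT.
have /(congr1 (fun k => k%:R : rat)) := wiener_vicsek VD degV.
rewrite cardV -/n -[vicsek s _]/(iter t.+1 (vicsek s) T) -[s.+1]addn1.
rewrite !(natrD, natrM, natrX) => /eqP; rewrite -subr_eq0 => /eqP.
rewrite !(natrD, natrM, natrX) in IH *; rewrite {}IH.
set W' : rat := (wiener _)%:R => WE.
have s0 : 3 * s%:R + 2 != 0 :> rat.
  by rewrite -natrM -natrD pnatr_eq0 addn2.
(* Goal and recursion both read [_ = 0]; replacing the zero by the recursion leaves an identity of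
   rational expressions. *)
apply/eqP; rewrite -subr_eq0; apply/eqP; rewrite -[RHS]WE {WE}.
(* The exponents of the induction hypothesis contain [t.-1], truncated at [t = 0]. *)
case: t W' {D VD degV cardV} => [|t] W'.
  by rewrite /= !expr0; field.
by rewrite /= ![(2 * _)%N]mulnC !exprM !exprS; field.
Qed.
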